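(* Let $K$ be a field, $S=K[x_1,\ldots,x_n]$, and let $I\subset S$ be a monomial ideal. If $I$ has linear quotients, then $I$ has componentwise linear quotients; that is, for every integer $a\ge 0$ the ideal $I_{\langle a\rangle}$ has linear quotients.
   Context: For a monomial ideal $I$, $G(I)$ denotes its unique minimal set of monomial generators. $I$ has linear quotients if there is an ordering $u_1,\ldots,u_m$ of $G(I)$ such that for each $i=2,\ldots,m$ the colon ideal $(u_1,\ldots,u_{i-1}):u_i$ is generated by a subset of the variables $\{x_1,\ldots,x_n\}$; such an ordering is called an admissible order of $G(I)$. (The zero ideal has linear quotients vacuously.) $I_{\langle a\rangle}$ denotes the ideal of $S$ generated by the degree-$a$ graded component of $I$ (equivalently, by all monomials of degree $a$ in $I$). *)

(* Defs.v *)
From mathcomp Require Import all_boot all_order all_algebra.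
From mathcomp Require Import mpoly.

Set Implicit Arguments.
Unset Strict Implicit.
Unset Printing Implicit Defensive.

Import GRing.Theory.
Local Open Scope ring_scope.

(* Ideals are Prop-valued predicates: the boolean [idealr] structure of
   [ring_quotient] only covers proper ideals. *)
Section Ideals.

Variable R : comNzRingType.

Definition ideal_gen (A : R -> Prop) (p : R) : Prop :=
  exists s : seq (R * R),
    (forall c, c \in s -> A c.2) /\ p = \sum_(c <- s) c.1 * c.2.

Definition colon (I : R -> Prop) (u p : R) : Prop := I (p * u).

End Ideals.

Section MonomialIdeals.

Variables (K : fieldType) (n : nat).

Implicit Types (I : {mpoly K[n]} -> Prop) (A : 'X_{1..n} -> Prop).

Definition mon_ideal A : {mpoly K[n]} -> Prop :=
  ideal_gen (fun p => exists2 m, A m & p = 'X_[m]).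

Definition var_ideal (V : {set 'I_n}) : {mpoly K[n]} -> Prop :=
  ideal_gen (fun p => exists2 i, i \in V & p = 'X_i).

Definition mon_generates A I : Prop := forall p, I p <-> mon_ideal A p.

Definition monomial_ideal I : Prop := exists A, mon_generates A I.

(* [A] is G(I): a set of monomial generators of [I] which is minimal for
   inclusion. *)
Definition minimal_mon_gens I A : Prop :=
  mon_generates A I /\
  forall B, (forall m, B m -> A m) -> mon_generates B I ->
    forall m, A m -> B m.

(* Positions are counted from 0, so the condition on u_2, ..., u_m is the one
   at 0 < i < size u; [take i u] lists the generators preceding the i-th. *)
Definition admissible_order I (u : seq 'X_{1..n}) : Prop :=
  [/\ uniq u,
      minimal_mon_gens I (fun m => m \in u) &
      forall i, (0 < i < size u)%N ->
        exists V : {set 'I_n}, forall p,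
          colon (mon_ideal (fun m => m \in take i u)) 'X_[nth 0%MM u i] p
            <-> var_ideal V p].

Definition has_linear_quotients I : Prop := exists u, admissible_order I u.

Definition component_ideal I (d : nat) : {mpoly K[n]} -> Prop :=
  ideal_gen (fun p => I p /\ p \is d.-homog).

Definition has_componentwise_linear_quotients I : Prop :=
  forall d : nat, has_linear_quotients (component_ideal I d).

End MonomialIdeals.

(* Main.v *)
(** Let u_1, ..., u_m be the admissible order of G(I), and for a monomial w of
    I let i(w) be the least i such that u_i divides w. The degree-d monomials
    of I, ordered first by i(w) and then lexicographically, form an admissible
    order of G(I_<d>).
    Let w' precede w, with i = i(w). If i(w') = i, replacing in w a variable
    x_l with w'_l < w_l (the first difference) by one with w'_m > w_m stays
    inside (u_i). If i(w') = j < i, the linear quotients of I give k < i and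
    x_l with u_k | x_l u_i and (u_j)_l > (u_i)_l; then w_l = (u_i)_l < w'_l by
    minimality of i(w). By minimality of G(I), deg u_k <= d, so some variable
    other than x_l can be removed from x_l w while keeping it divisible by
    u_k. *)
Require Import Defs.
From mathcomp Require Import all_boot all_order all_algebra.
From mathcomp Require Import mpoly zify.

Set Implicit Arguments.
Unset Strict Implicit.
Unset Printing Implicit Defensive.

Import Order.TTheory GRing.Theory.

(** * Prefixes of sorted sequences *)

Section SortedPrefix.

Variables (T : eqType) (r : rel T).
Hypotheses (r_trans : transitive r) (r_anti : antisymmetric r).

(** Turns precedence by position into a comparison for [r], the form in which prefixes of
    [degree_part] are handled. *)
Lemma mem_take_sorted (x0 : T) (s : seq T) i x :
    sorted r s -> uniq s -> (i < size s)%N -> x \in s ->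
  (x \in take i s) = r x (nth x0 s i) && (x != nth x0 s i).
Proof.
move=> r_s s_uniq lti xs; rewrite in_take //.
have ys := mem_nth x0 lti; have idx := index_uniq x0 lti s_uniq.
apply/idP/andP => [lt_xi|[rxy neq_xy]].
  split; first by apply: (sorted_ltn_index r_trans r_s); rewrite ?idx.
  by apply: contraTneq lt_xi => ->; rewrite idx ltnn.
rewrite ltnNge leq_eqVlt negb_or; apply/andP; split.
  by apply: contraNneq neq_xy => ->; rewrite nth_index.
apply: contraNN neq_xy => lt_ix; apply/eqP/r_anti; rewrite rxy /=.
by apply: (sorted_ltn_index r_trans r_s); rewrite ?idx.
Qed.

End SortedPrefix.

(** * Divisibility and degree of monomials *)

Section Multinomials.

Variable n : nat.
Implicit Types (a b c m w : 'X_{1..n}) (u : seq 'X_{1..n}).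

Lemma lem_mdeg a b : (a <= b)%MM -> (mdeg a <= mdeg b)%N.
Proof. by move/submK <-; rewrite mdegD leq_addl. Qed.

Lemma lem_mdeg_eq a b : (a <= b)%MM -> (mdeg b <= mdeg a)%N -> a = b.
Proof.
move=> le_ab le_deg; have := congr1 (@mdeg n) (submK le_ab).
rewrite mdegD => deg_b.
have /eqP : mdeg (b - a) = 0%N by lia.
by rewrite mdeg_eq0 => /eqP eq0; rewrite -(submK le_ab) eq0 add0m.
Qed.

Lemma mdeg_ltn_witness a b :
  a != b -> (mdeg a <= mdeg b)%N -> exists i, (a i < b i)%N.
Proof.
move=> neq_ab le_ab; apply/existsP; apply: contraNT neq_ab => /existsPn nlt.
rewrite eq_sym; apply/eqP/lem_mdeg_eq => //; apply/mnm_lepP => i.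
by rewrite leqNgt nlt.
Qed.

(** By degree, [c] is a proper divisor of [w + U_(l)], so some variable can be divided out without
    losing divisibility by [c]. *)
Lemma lem_exchange c w l :
    (c <= w + U_(l))%MM -> (mdeg c <= mdeg w)%N ->
  exists w', [/\ mdeg w' = mdeg w, (c <= w')%MM & (w' <= w + U_(l))%MM].
Proof.
move=> le_cw deg_c.
have [||j lt_j] := @mdeg_ltn_witness c (w + U_(l))%MM.
- by apply: contraTneq deg_c => ->; rewrite mdegD mdeg1 addn1 ltnn.
- exact: lem_mdeg.
have le_j : (U_(j) <= w + U_(l))%MM.
  by rewrite lep1mP -lt0n; case: (c j) lt_j; lia.
exists (w + U_(l) - U_(j))%MM; split; last exact: lem_subr.
- have := congr1 (@mdeg n) (submK le_j); rewrite !mdegD !mdeg1; lia.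
- apply/mnm_lepP => k; have /mnm_lepP/(_ k) := le_cw.
  by rewrite mnmBE (mnm1E j); case: eqP => [<-|]; lia.
Qed.

(** Combinatorial form of admissibility: x_l divides a / gcd(a, u_i), and the clause on [b] puts x_l
    in the colon ideal. *)
Definition linear_quotients_seq u := forall i, (i < size u)%N ->
  forall a, a \in take i u ->
  exists2 l, (nth 0%MM u i l < a l)%N &
    exists2 b, b \in take i u & (b <= nth 0%MM u i + U_(l))%MM.

Definition lem_antichain u := forall a b, a \in u -> b \in u ->
  (a <= b)%MM -> a = b.

(** * The ordered degree-[d] monomials of the ideal *)

Section DegreePart.

Variables (u : seq 'X_{1..n}) (d : nat).

(** The index i(w), counted from 0; it equals [size u] when no element of [u] divides [w]. *)
Definition first_div w := find (fun a => (a <= w)%MM) u.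

Definition first_div_le : rel 'X_{1..n} := fun w w' =>
  (first_div w < first_div w')%N ||
    ((first_div w == first_div w') && (w <= w')%O).

Lemma first_div_le_total : total first_div_le.
Proof.
by move=> w w'; rewrite /first_div_le; case: ltngtP => //= _; apply: le_total.
Qed.

Lemma first_div_le_trans : transitive first_div_le.
Proof.
move=> w2 w1 w3; rewrite /first_div_le.
case: ltngtP => //= [lt12 _|->]; last first.
  by case: ltngtP => //= _; apply: le_trans.
case: (ltngtP _ (first_div w3)) => //= [lt23|<-] _; last by rewrite lt12.
by rewrite (ltn_trans lt12).
Qed.

Lemma first_div_le_anti : antisymmetric first_div_le.
Proof.
by move=> w w'; rewrite /first_div_le; case: ltngtP => //= _; apply: le_anti.
Qed.

(** The monomials of degree less than [d.+1] form a finite type, which makes them enumerable. *)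
Definition degree_part : seq 'X_{1..n} :=
  sort first_div_le
    [seq w <- [seq bmnm w | w : 'X_{1..n < d.+1}] |
      (mdeg w == d) && has (fun a => (a <= w)%MM) u].

Lemma mem_degree_part w :
  (w \in degree_part) = (mdeg w == d) && has (fun a => (a <= w)%MM) u.
Proof.
rewrite mem_sort mem_filter; case: eqP => //= deg_w.
rewrite andb_idr // => _; have lt_w : (mdeg w < d.+1)%N by rewrite deg_w.
by apply/mapP; exists (BMultinom lt_w); rewrite ?mem_enum.
Qed.

Lemma degree_part_uniq : uniq degree_part.
Proof.
by rewrite sort_uniq filter_uniq // map_inj_uniq ?enum_uniq //; apply: val_inj.
Qed.

Lemma mem_take_degree_part i w : (i < size degree_part)%N ->
  let wi := nth 0%MM degree_part i in
  (w \in take i degree_part) =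
    [&& w \in degree_part, first_div_le w wi & w != wi].
Proof.
move=> lti /=; have [w_in|w_notin] := boolP (w \in degree_part); last first.
  by apply: contraNF w_notin; apply: mem_take.
apply: (mem_take_sorted first_div_le_trans first_div_le_anti) => //.
  exact/sort_sorted/first_div_le_total.
exact: degree_part_uniq.
Qed.

Hypotheses (u_lq : linear_quotients_seq u) (u_anti : lem_antichain u).

(* The last clause places [w''] before [w] in [degree_part]. *)
Lemma degree_part_step w w' :
    w \in degree_part -> w' \in degree_part -> w' != w -> first_div_le w' w ->
  exists2 l, (w l < w' l)%N &
    exists w'', [/\ w'' \in degree_part, (w'' <= w + U_(l))%MM, w'' != w &
      first_div_le w'' w].
Proof.
rewrite !mem_degree_part => /andP[/eqP deg_w has_w] /andP[/eqP deg_w' has_w'].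
have ltw : (first_div w < size u)%N by rewrite -has_find.
move=> neq; set i := first_div w; set c := nth 0%MM u i.
have le_cw : (c <= w)%MM := nth_find 0%MM has_w.
have c_u : c \in u by apply: mem_nth.
have first_div_c w'' : (c <= w'')%MM -> (first_div w'' <= i)%N.
  by move=> le_c; rewrite leqNgt; apply/negP => /(before_find 0%MM) /=; rewrite le_c.
case/orP => [lt_i|/andP[/eqP eq_i le_ww]].
(* Case i(w') < i(w): [a] is the first element of [u] dividing [w'], and it precedes [c]. *)
- have := nth_find 0%MM has_w'; rewrite -/(first_div w').
  set a := nth _ _ _ => le_aw'.
  have a_in : a \in take i u.
    by rewrite /a -(nth_take _ lt_i) mem_nth // size_takel // ltnW.
  have [l lt_l [b b_in le_b]] := u_lq ltw a_in.
  have nle_bw : ~~ (b <= w)%MM.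
    have : ~~ has (fun a => (a <= w)%MM) (take i u).
      by rewrite has_take // ltnn.
    by move/hasPn/(_ b b_in).
  (* If c_l < w_l, then c x_l divides [w], and so does [b]. *)
  have w_l : w l = c l.
    apply/eqP; rewrite eqn_leq (mnm_lepP le_cw) andbT leqNgt.
    apply: contraNN nle_bw => lt_cw; apply: lepm_trans le_b _.
    apply/mnm_lepP => k; rewrite mnmDE mnm1E; have := mnm_lepP le_cw k.
    by rewrite -/c; case: eqP => [<-|_] /=; lia.
  exists l; first by rewrite w_l (leq_trans lt_l) // (mnm_lepP le_aw').
  have le_bwl : (b <= w + U_(l))%MM.
    apply: lepm_trans le_b _; apply/mnm_lepP => k; rewrite !mnmDE leq_add2r.
    exact: (mnm_lepP le_cw).
  have b_u := mem_take b_in.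
  (* Otherwise deg b > deg c, which forces b = c x_l, a proper multiple of [c] in the antichain
     [u]. *)
  have deg_b : (mdeg b <= mdeg w)%N.
    rewrite leqNgt; apply/negP => lt_wb.
    have deg_cw := lem_mdeg le_cw.
    have eq_b : b = (c + U_(l))%MM.
      by apply: lem_mdeg_eq le_b _; rewrite mdegD mdeg1 addn1 (leq_ltn_trans deg_cw).
    have eq_cb : c = b by apply: u_anti => //; rewrite eq_b lem_addr.
    by rewrite -eq_cb ltnNge deg_cw in lt_wb.
  have [w'' [deg_w'' le_bw'' le_w'']] := lem_exchange le_bwl deg_b.
  exists w''; split => //.
  + rewrite mem_degree_part deg_w'' deg_w eqxx /=.
    by apply/hasP; exists b.
  + by apply: contraNneq nle_bw => <-.
  + apply/orP; left; rewrite -has_take //; first by apply/hasP; exists b.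
    by apply/hasP; exists b.
(* Case i(w') = i(w): [l] is the first index where [w'] and [w] differ, and [m] an index where [w']
   is larger. *)
- have lt_ww : (w' < w)%O by rewrite lt_neqAle neq.
  have deg_ww : mdeg w' = mdeg w by rewrite deg_w.
  have /(ltmcP deg_ww) [l eq_l lt_l] := lt_ww.
  have [||m lt_m] := @mdeg_ltn_witness w w'; rewrite 1?eq_sym ?deg_ww //.
  have le_cw' : (c <= w')%MM by rewrite /c /i -eq_i; apply: (nth_find 0%MM has_w').
  have neq_ml : m != l by apply: contraTneq lt_m => ->; rewrite -leqNgt ltnW.
  have lt_lm : (l < m)%N.
    rewrite ltn_neqAle eq_sym neq_ml /= leqNgt; apply/negP => /eq_l eq_m.
    by rewrite eq_m ltnn in lt_m.
  have le_l : (U_(l) <= w + U_(m))%MM by rewrite lep1mP mnmDE; lia.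
  exists m => //; exists (w + U_(m) - U_(l))%MM; set w'' := (_ - _)%MM.
  have deg_w'' : mdeg w'' = mdeg w.
    have := congr1 (@mdeg n) (submK le_l); rewrite -/w'' !mdegD !mdeg1; lia.
  (* Only the exponent of x_l drops, by one, and there c_l <= w'_l < w_l. *)
  have le_cw'' : (c <= w'')%MM.
    apply/mnm_lepP => k; rewrite /w'' mnmBE mnmDE !mnm1E.
    have := mnm_lepP le_cw k; have := mnm_lepP le_cw' k.
    by case: (l =P k) => [<-|_]; lia.
  (* Since l < m, the first change is the decrease at [l]. *)
  have lt_w'' : (w'' < w)%O.
    apply/(ltmcP deg_w''); exists l => [k lt_kl|]; rewrite /w'' mnmBE mnmDE !mnm1E.
      by rewrite -!val_eqE /=; lia.
    by rewrite eqxx (negPf neq_ml); lia.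
  split; [|exact: lem_subr|by rewrite lt_eqF|].
  + rewrite mem_degree_part deg_w'' deg_w eqxx /=.
    by apply/hasP; exists c.
  + have := first_div_c w'' le_cw''.
    by rewrite leq_eqVlt /first_div_le => /orP[->|->] //; rewrite (ltW lt_w'') orbT.
Qed.

Lemma degree_part_linear_quotients : linear_quotients_seq degree_part.
Proof.
move=> i lti w'; rewrite (mem_take_degree_part _ lti) => /and3P[w'_in le_w' neq].
have [l lt_l [w'' [w''_in le_l neq'' le_w'']]] :=
  degree_part_step (mem_nth 0%MM lti) w'_in neq le_w'.
by exists l => //; exists w''; rewrite // (mem_take_degree_part _ lti) w''_in le_w''.
Qed.

End DegreePart.

End Multinomials.

Local Open Scope ring_scope.

(** * Closure properties of generated ideals *)

Section GeneratedIdeals.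

Variable R : comNzRingType.
Implicit Types (A B J : R -> Prop) (p q : R).

Lemma ideal_gen_in A p : A p -> ideal_gen A p.
Proof.
move=> Ap; exists [:: (1, p)]; rewrite big_seq1 mul1r; split=> // c.
by rewrite inE => /eqP ->.
Qed.

Lemma ideal_gen0 A : ideal_gen A 0.
Proof. by exists [::]; rewrite big_nil. Qed.

Lemma ideal_genD A p q : ideal_gen A p -> ideal_gen A q -> ideal_gen A (p + q).
Proof.
move=> [s [sA ->]] [t [tA ->]]; exists (s ++ t); rewrite big_cat; split=> // c.
by rewrite mem_cat => /orP[/sA|/tA].
Qed.

Lemma ideal_genMl A p q : ideal_gen A q -> ideal_gen A (p * q).
Proof.
move=> [s [sA ->]]; exists [seq (p * c.1, c.2) | c <- s]; split.
  by move=> _ /mapP[c /sA ? ->].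
by rewrite big_map mulr_sumr; apply: eq_bigr => c _; rewrite mulrA.
Qed.

Lemma ideal_gen_sub A B :
  (forall p, A p -> ideal_gen B p) -> forall p, ideal_gen A p -> ideal_gen B p.
Proof.
move=> AB p [s [sA ->]]; rewrite big_seq.
elim/big_ind: _ => [||c cs]; first exact: ideal_gen0.
  exact: ideal_genD.
exact/ideal_genMl/AB/sA.
Qed.

End GeneratedIdeals.

(** * From ideals to divisibility of monomials *)

Section MonomialIdeals.

Variables (K : fieldType) (n : nat).
Implicit Types (A B : 'X_{1..n} -> Prop) (p : {mpoly K[n]}).
Implicit Types (I : {mpoly K[n]} -> Prop) (u : seq 'X_{1..n}).

(** The support of a sum lies in the union of the supports; conversely, [p] is the sum of its
    terms. *)
Lemma mon_idealP A p : mon_ideal A p <->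
  {in msupp p, forall m, exists2 a, A a & (a <= m)%MM}.
Proof.
split=> [[s [sA ->]] m /msupp_sum_le /flatten_mapP[c]|sup_p].
  rewrite filter_predT => /sA [a Aa ->]; rewrite (perm_mem (msuppMX _ _)).
  by move=> /mapP[m' _ ->]; exists a => //; apply: lem_addr.
rewrite (mpolyE p) big_seq.
elim/big_ind: _ => [||m m_p]; [exact: ideal_gen0|exact: ideal_genD|].
have [a Aa le_am] := sup_p m m_p.
rewrite -(submK le_am) mpolyXD scalerAl.
by apply/ideal_genMl/ideal_gen_in; exists a.
Qed.

Lemma mon_idealX A m :
  mon_ideal A ('X_[m] : {mpoly K[n]}) <-> exists2 a, A a & (a <= m)%MM.
Proof.
rewrite mon_idealP; split=> [|[a Aa le_am] m']; first by apply; rewrite msuppX inE.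
by rewrite msuppX inE => /eqP ->; exists a.
Qed.

Lemma var_idealP (V : {set 'I_n}) p : var_ideal V p <->
  {in msupp p, forall m, exists2 i, i \in V & (U_(i) <= m)%MM}.
Proof.
have -> : var_ideal V p <->
    mon_ideal (fun m => exists2 i, i \in V & m = U_(i)%MM) p.
  split; apply: ideal_gen_sub => q.
    by move=> [i iV ->]; apply: ideal_gen_in; exists U_(i)%MM => //; exists i.
  by move=> [_ [i iV ->] ->]; apply: ideal_gen_in; exists i.
rewrite mon_idealP; split=> sup_p m /sup_p.
  by move=> [_ [i iV ->]]; exists i.
by move=> [i iV le_im]; exists U_(i)%MM => //; exists i.
Qed.

Lemma colon_mon_idealP A c p : colon (mon_ideal A) 'X_[c] p <->
  {in msupp p, forall m, exists2 a, A a & (a <= c + m)%MM}.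
Proof.
rewrite /colon mon_idealP; split=> sup_p m m_p.
  by apply: sup_p; rewrite (perm_mem (msuppMX _ _)) map_f.
by move: m_p; rewrite (perm_mem (msuppMX _ _)) => /mapP[m' /sup_p ? ->].
Qed.

(** If [a] properly divided [b], the generators other than [b] would still generate [I]. *)
Lemma minimal_mon_gens_antichain I u :
  minimal_mon_gens I (fun m => m \in u) -> lem_antichain u.
Proof.
move=> [u_gen u_min] a b a_u b_u le_ab; apply/eqP/negPn/negP => neq_ab.
suff B_gen : mon_generates (fun m => (m \in u) && (m != b)) I.
  have : (b \in u) && (b != b) by apply: (u_min _ _ B_gen b b_u) => m /andP[].
  by rewrite eqxx andbF.
move=> p; rewrite u_gen !mon_idealP; split=> sup_p m /sup_p [c c_u le_cm].
  have [eq_cb|neq_cb] := eqVneq c b; last by exists c; rewrite ?c_u.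
  by exists a; rewrite ?a_u // (lepm_trans le_ab) // -eq_cb.
by exists c => //; case/andP: c_u.
Qed.

Lemma equigenerated_minimal I A d :
    mon_generates A I -> (forall m, A m -> mdeg m = d) -> minimal_mon_gens I A.
Proof.
move=> A_gen A_deg; split=> // B BA B_gen m Am.
have : mon_ideal B ('X_[m] : {mpoly K[n]}).
  by apply/(B_gen _)/(A_gen _)/mon_idealX; exists m; rewrite ?lepm_refl.
move=> /mon_idealX [b Bb le_bm]; suff <- : b = m by [].
by apply: lem_mdeg_eq => //; rewrite !A_deg //; apply: BA.
Qed.

Lemma admissible_orderP I u : admissible_order I u <->
  [/\ uniq u, minimal_mon_gens I (fun m => m \in u) & linear_quotients_seq u].
Proof.
split=> [[u_uniq u_min u_adm]|[u_uniq u_min u_lq]]; split=> // i.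
- move=> lti a a_in; set c := nth _ _ _.
  (* At position 0 the prefix is empty, so the range 0 < i loses nothing. *)
  have i_gt0 : (0 < i)%N by case: (i) a_in; rewrite // take0.
  have [|V colonV] := u_adm i; first by rewrite i_gt0.
  (* Subtraction is truncated: [a - c] is the exponent of a / gcd(a, c), which lies in the colon
     ideal; a variable of [V] dividing it gives [l]. *)
  have /colonV/var_idealP : colon (mon_ideal (fun m => m \in take i u)) 'X_[c]
      ('X_[a - c] : {mpoly K[n]}).
    apply/colon_mon_idealP => m /mem_msuppXP <-; exists a => //.
    by apply/mnm_lepP => k; rewrite mnmDE mnmBE; lia.
  move=> /(_ (a - c)%MM) []; first by rewrite msuppX inE.
  move=> l lV; rewrite lep1mP mnmBE -lt0n subn_gt0 => lt_l.
  exists l => //.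
  have /colonV/colon_mon_idealP/(_ U_(l)%MM) : var_ideal V ('X_l : {mpoly K[n]}).
    by apply: ideal_gen_in; exists l.
  by apply; rewrite msuppX inE.
- move=> /andP[_ lti]; set c := nth _ _ _.
  (* [V] consists of all the variables that lie in the colon ideal. *)
  exists [set l | has (fun b => (b <= c + U_(l))%MM) (take i u)] => p.
  rewrite colon_mon_idealP var_idealP; split=> sup_p m /sup_p.
    move=> [a a_in le_a]; have [l lt_l [b b_in le_b]] := u_lq i lti a a_in.
    exists l; first by rewrite inE; apply/hasP; exists b.
    have := mnm_lepP le_a l; rewrite lep1mP mnmDE -/c in lt_l *; lia.
  move=> [l]; rewrite inE => /hasP[b b_in le_b] le_l; exists b => //.
  apply: lepm_trans le_b _; apply/mnm_lepP => k.
  by rewrite !mnmDE leq_add2l (mnm_lepP le_l).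
Qed.

(** Every monomial of a form of degree [d] in [I] has degree [d] and is divisible by an element of
    [u]. *)
Lemma degree_part_generates I u d : mon_generates (fun m => m \in u) I ->
  mon_generates (fun w => w \in degree_part u d) (component_ideal I d).
Proof.
move=> u_gen p; split; apply: ideal_gen_sub => q.
  move=> [] /(u_gen _)/mon_idealP sup_q /dhomogP q_homog; apply/mon_idealP => m m_q.
  have [a a_u le_am] := sup_q m m_q; exists m; rewrite ?lepm_refl //.
  rewrite mem_degree_part (q_homog m m_q) eqxx.
  by apply/hasP; exists a.
move=> [w]; rewrite mem_degree_part => /andP[deg_w /hasP[a a_u le_aw]] ->.
apply: ideal_gen_in; rewrite dhomogX; split=> //.
by apply/(u_gen _)/mon_idealX; exists a.
Qed.

End MonomialIdeals.

Theorem theorem2p7 (K : fieldType) (n : nat) (I : {mpoly K[n]} -> Prop)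
    (hmon : monomial_ideal I) (hlq : has_linear_quotients I) :
  has_componentwise_linear_quotients I.
Proof.
move=> d; have [u /admissible_orderP [_ u_min u_lq]] := hlq.
exists (degree_part u d); apply/admissible_orderP; split.
- exact: degree_part_uniq.
- apply: (@equigenerated_minimal _ _ _ _ d).
    exact/degree_part_generates/(proj1 u_min).
  by move=> w; rewrite mem_degree_part => /andP[/eqP].
(* Minimality of G(I) enters here, as the antichain condition on [u]. *)
- exact/degree_part_linear_quotients/(minimal_mon_gens_antichain u_min).
Qed.
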